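(* Let $\gamma=(\gamma_s)_{s=1}^\infty$ be a sequence of positive numbers with $\gamma_k\le 1/32$ for all $k\in\mathbb N$ and $\sum_{k=1}^\infty\gamma_k<\infty$, and put $C_0=\exp\left(16\sum_{k=1}^\infty\gamma_k\right)$. Let $K(\gamma)$ and $Y_{s-1}$ be as defined in the context. Let $s\in\mathbb N$, $N=2^s-1$, and let $X$ consist of all points of $Y_{s-1}$ except one. Then $\Lambda_N(X,K(\gamma))>C_0^{-1}(N-2)$.
   Context: Given $\gamma=(\gamma_s)_{s\ge1}$ with $0<\gamma_s<1/4$, let $r_0=1$ and $r_s=\gamma_s r_{s-1}^2$ for $s\in\mathbb N$. Define $P_2(x)=x(x-1)$ and $P_{2^{s+1}}=P_{2^s}(P_{2^s}+r_s)$ for $s\in\mathbb N$. For $s\ge 0$ let $E_s=\{x\in\mathbb R: P_{2^{s+1}}(x)\le 0\}$; thus $E_0=[0,1]$, and $E_s=\bigcup_{j=1}^{2^s}I_{j,s}$ is a disjoint union of $2^s$ closed intervals (basic intervals of level $s$). Put $K(\gamma)=\bigcap_{s=0}^\infty E_s$. For $s\ge1$, $Y_{s-1}$ denotes the set of the $2^s$ endpoints of the intervals $I_{j,s-1}$, $1\le j\le 2^{s-1}$ (equivalently, the set of zeros of $P_{2^s}$). Lebesgue constant: for a set $Z=\{x_1,\dots,x_N\}$ of $N$ distinct points of a compact set $K\subset\mathbb R$, let $l_k(x)=\prod_{i\ne k}\frac{x-x_i}{x_k-x_i}$ ($1\le k\le N$) and $\Lambda_N(Z,K)=\sup_{x\in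 K}\sum_{k=1}^N|l_k(x)|$. *)

(* Defs.v *)
From HB Require Import structures.
From mathcomp Require Import all_boot all_order all_algebra.
From mathcomp Require Import all_classical all_reals all_analysis.

Set Implicit Arguments.
Unset Strict Implicit.
Unset Printing Implicit Defensive.

Import Order.TTheory GRing.Theory Num.Theory.
Import numFieldNormedType.Exports.

Local Open Scope classical_set_scope.
Local Open Scope ring_scope.

(* Throughout, a sequence (gamma_s)_{s >= 1} is a function on nat whose value
   at 0 is never used. *)

Fixpoint r {R : realType} (gamma : nat -> R) (s : nat) : R :=
  if s is s'.+1 then gamma s * r gamma s' ^+ 2 else 1.

(* The index is shifted: [P gamma s] is the polynomial P_{2^(s+1)}, of degree
   2^(s+1), whose nonpositivity set is E_s. *)
Fixpoint P {R : realType} (gamma : nat -> R) (s : nat) : {poly R} :=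
  if s is s'.+1 then P gamma s' * (P gamma s' + (r gamma s)%:P)
  else 'X * ('X - 1).

Definition E {R : realType} (gamma : nat -> R) (s : nat) : set R :=
  [set x | (P gamma s).[x] <= 0].

Definition K {R : realType} (gamma : nat -> R) : set R :=
  \bigcap_(s in [set: nat]) E gamma s.

(* The decomposition of E_s into finitely many disjoint closed intervals is its
   decomposition into connected components. The condition [E gamma s a]
   excludes b < a, where both sides of the equation would be empty. *)
Definition basic_interval {R : realType} (gamma : nat -> R) (s : nat)
    (a b : R) : Prop :=
  E gamma s a /\ connected_component (E gamma s) a = [set` `[a, b]].

Definition Y {R : realType} (gamma : nat -> R) (s : nat) : set R :=
  [set x | exists a b, basic_interval gamma s a b /\ (x = a \/ x = b)].

(* Meaningful for finite Z only: finitely supported big operators ignore a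
   family of infinite support. *)
Definition lagrange {R : realType} (Z : set R) (z x : R) : R :=
  \big[*%R/1]_(w \in Z `\ z) ((x - w) / (z - w)).

Definition lebesgue_constant {R : realType} (Z A : set R) : \bar R :=
  ereal_sup [set (\sum_(z \in Z) `|lagrange Z z x|)%:E | x in A].

(* Main.v *)
(* The removed point y lies in K(gamma), and evaluating there already suffices.
   With p = P_(2^s), whose zeros are the points of Y_(s-1), l_z(y) = - p'(y) / p'(z).
   The chain rule for the recursion gives, at every zero z of p,
     D prod_(k <= s) (1 - 4 gamma_k) <= |p'(z)| <= D,  D = r_1 ... r_(s-1),
   so each of the N terms |l_z(y)| is at least
   prod_(k <= s) (1 - 4 gamma_k) >= exp (- 16 sum_k gamma_k) = 1 / C0. *)
Require Import Defs.
From HB Require Import structures.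
From mathcomp Require Import all_boot all_order all_algebra.
From mathcomp Require Import all_classical all_reals all_analysis.
From mathcomp Require Import ring lra.

Set Implicit Arguments.
Unset Strict Implicit.
Unset Printing Implicit Defensive.

Import Order.TTheory GRing.Theory Num.Theory.
Import numFieldNormedType.Exports.

Local Open Scope classical_set_scope.
Local Open Scope ring_scope.

(** * Components of [p <= 0] and their endpoints *)

Lemma connected_component_segment (R : realType) (A : set R) (c d x : R) :
  closed A -> A `<=` `[c, d] -> A x ->
  exists a b, connected_component A x = [set` `[a, b]].
Proof.
move=> Acl Acd Ax; set C := connected_component A x.
have Cx : C x by exact: connected_component_refl.
have C0 : C !=set0 by exists x.
have Cc : compact C.
  apply: (@subclosed_compact _ C `[c, d]).
  - exact: component_closed.
  - exact: segment_compact.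
  - by move=> y /connected_component_sub /Acd.
(* The extreme values of the identity on the compact set [C] are its least and greatest elements,
   the future endpoints. *)
have idc : {within C, continuous (id : R -> R)}.
  by apply: continuous_subspaceT => y; exact: cvg_id.
have [a aC aP] := compact_EVT_min C0 Cc idc.
have [b bC bP] := compact_EVT_max C0 Cc idc.
have Ci : is_interval C by apply/connected_intervalP; exact: component_connected.
exists a, b; apply/seteqP; split=> y /=; rewrite in_itv /=.
  by move=> Cy; rewrite aP ?bP// inE.
by move=> aby; apply: (Ci a b) => //; rewrite -inE.
Qed.

Lemma closed_horner_le0 (R : realType) (p : {poly R}) :
  closed [set x : R | p.[x] <= 0].
Proof.
have /continuous_closedP/(_ _ (@closed_le R 0)) := @continuous_horner R p.
by [].
Qed.

Lemma ball_connected_component_horner_le0 (R : realType) (p : {poly R}) (a : R) :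
  p.[a] < 0 -> exists2 e, 0 < e &
    [set` `[a - e, a + e]] `<=` connected_component [set x | p.[x] <= 0] a.
Proof.
move=> pa; have := @continuous_horner R p a.
move=> /cvgr_lt/(_ _ pa)/nbhs_ballP[e /= e0 He].
have e20 : 0 < e / 2 by rewrite divr_gt0.
exists (e / 2) => //; apply: connected_component_max.
- by rewrite /= in_itv/=; lra.
- move=> x /=; rewrite in_itv/= => xae; apply/ltW/He.
  by rewrite /ball/= ltr_norml; lra.
- exact/connected_intervalP/interval_is_interval.
Qed.

Lemma deriv_eq0_of_local_max (R : realType) (p : {poly R}) (a b x : R) :
  a < x < b -> (forall t, a < t < b -> p.[t] <= p.[x]) -> p^`().[x] = 0.
Proof.
move=> /andP[ax xb] pmax.
have xab : x \in `]a, b[ by rewrite in_itv/= ax.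
have := @derive1_at_max R (horner p) a b x (ltW (lt_trans ax xb)).
move=> /(_ (fun t _ => @derivable_horner R p t))/(_ xab) H.
have {}H : is_derive x 1 (horner p) 0.
  by apply: H => t; rewrite in_itv/=; exact: pmax.
rewrite -(derive_val (is_derive := is_derive_poly p x)).
by rewrite (derive_val (is_derive := H)).
Qed.

(** An endpoint with [p < 0] would be interior to its component. Conversely, a zero strictly inside
    a component is a local maximum of [p], so [p'] vanishes there, contradicting simplicity. *)
Lemma endpoints_horner_le0 (R : realType) (p : {poly R}) (c d x : R) :
  [set t | p.[t] <= 0] `<=` `[c, d] ->
  (forall t, p.[t] = 0 -> p^`().[t] != 0) ->
  (exists a b, (p.[a] <= 0 /\
      connected_component [set t | p.[t] <= 0] a = [set` `[a, b]]) /\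
      (x = a \/ x = b)) <-> p.[x] = 0.
Proof.
move=> bnd simple; set A := [set t | p.[t] <= 0]; split.
  move=> [a [b [[pa Cab] xab]]].
  have ab : a <= b.
    have : connected_component A a a by exact: connected_component_refl.
    by rewrite Cab /= in_itv/= lexx.
  have Cx : connected_component A a x.
    by rewrite Cab /= in_itv/=; case: xab => ->; rewrite lexx ?ab.
  have := connected_component_sub Cx; rewrite /A/= le_eqVlt => /orP[/eqP//|px].
  have [e e0] := ball_connected_component_horner_le0 px.
  rewrite -/A -(same_connected_component Cx) Cab => sub.
  have /sub : [set` `[x - e, x + e]] (x - e) by rewrite /= in_itv/=; lra.
  have /sub : [set` `[x - e, x + e]] (x + e) by rewrite /= in_itv/=; lra.
  rewrite /= !in_itv/= => /andP[? ?] /andP[? ?]; exfalso.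
  by case: xab => ?; subst x; lra.
move=> px; have Ax : A x by rewrite /A/= px.
have [a [b Cab]] := connected_component_segment (closed_horner_le0 (p := p)) bnd Ax.
have Cx : connected_component A x x by exact: connected_component_refl.
have := Cx; rewrite Cab /= in_itv/= => /andP[ax xb].
have Ca : connected_component A x a.
  by rewrite Cab /= in_itv/= lexx (le_trans ax xb).
exists a, b; split.
  split; first exact: connected_component_sub Ca.
  by rewrite -(same_connected_component Ca).
have [->|xa] := eqVneq x a; first by left.
have [->|xb'] := eqVneq x b; first by right.
have /negP[] := simple _ px; apply/eqP.
apply: (@deriv_eq0_of_local_max _ _ a b).
  by rewrite !lt_neqAle ax xb eq_sym xa xb'.
move=> t /andP[at_ tb]; rewrite px.
suff /connected_component_sub : connected_component A x t by [].
by rewrite Cab /= in_itv/= !ltW.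
Qed.

(** * Roots, simple factors and Lagrange polynomials *)

Lemma quadratic_roots (R : rcfType) (b c : R) :
  0 < b -> - (b ^+ 2 / 4) < c <= 0 ->
  exists u v, [/\ u != v, u + v = - b, u * v = - c, - b <= u <= 0 & - b <= v <= 0].
Proof.
(* The discriminant of $X^2 + bX - c$ lies in $(0, b^2]$: the roots are real, distinct and stay in
   $[-b, 0]$. *)
move=> b0 /andP[c1 c0]; set d := Num.sqrt (b ^+ 2 + 4 * c).
have d2 : d ^+ 2 = b ^+ 2 + 4 * c by rewrite sqr_sqrtr//; lra.
have d0 : 0 < d by rewrite sqrtr_gt0; lra.
have db : d <= b by rewrite -ler_sqr ?nnegrE ?(ltW d0) ?(ltW b0)// d2; lra.
exists ((- b - d) / 2), ((- b + d) / 2); split; lra.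
Qed.

(** At a common root [p] would take both values [u] and [v]. *)
Lemma uniq_cat_prod_XsubC (R : idomainType) (p : {poly R}) (u v : R)
    (s t : seq R) :
  u != v -> uniq s -> uniq t ->
  p - u%:P = \prod_(z <- s) ('X - z%:P) ->
  p - v%:P = \prod_(z <- t) ('X - z%:P) ->
  uniq (s ++ t).
Proof.
move=> uv us ut ps pt; rewrite cat_uniq us ut andbT /=.
apply/hasPn => z zt; apply/negP => zs.
have /eqP : (p - v%:P).[z] = 0 by apply/rootP; rewrite pt root_prod_XsubC.
have /eqP : (p - u%:P).[z] = 0 by apply/rootP; rewrite ps root_prod_XsubC.
by rewrite !hornerE !subr_eq0 => /eqP -> /eqP e; rewrite e eqxx in uv.
Qed.

Lemma deriv_prod_XsubC (R : idomainType) (s : seq R) (z : R) :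
  z \in s ->
  (\prod_(w <- s) ('X - w%:P))^`().[z] = \prod_(w <- rem z s) (z - w).
Proof.
move=> zs; rewrite (big_rem z)//= derivM derivXsubC mul1r !hornerE subrr mul0r.
rewrite addr0 horner_prod; apply: eq_bigr => w _; exact: hornerXsubC.
Qed.

Lemma deriv_prod_XsubC_neq0 (R : idomainType) (s : seq R) (z : R) :
  uniq s -> z \in s -> (\prod_(w <- s) ('X - w%:P))^`().[z] != 0.
Proof.
move=> us zs; rewrite deriv_prod_XsubC// prodf_seq_neq0; apply/allP => w.
by rewrite mem_rem_uniq// inE subr_eq0 eq_sym => /andP[].
Qed.

(** Both derivatives are products of differences of nodes; once the common factor $|y - z|$ is
    cancelled, their quotient is the Lagrange quotient over the nodes other than [y] and [z]. *)
Lemma norm_lagrange_node (R : realType) (s : seq R) (y z : R) :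
  uniq s -> y \in s -> z \in s -> z != y ->
  let p := \prod_(w <- s) ('X - w%:P) in
  `|Defs.lagrange ([set` s] `\ y) z y| = `|p^`().[y]| / `|p^`().[z]|.
Proof.
move=> us ys zs zy p; rewrite /Defs.lagrange.
have -> : ([set` s] `\ y) `\ z = [set` rem z (rem y s)].
  apply/seteqP; split=> w /=; rewrite mem_rem_uniq ?rem_uniq// inE.
    by move=> [[ws /eqP wy] /eqP wz]; rewrite wz mem_rem_uniq// inE wy ws.
  by rewrite mem_rem_uniq// inE => /and3P[/eqP wz /eqP wy ws].
rewrite -fsbig_seq ?rem_uniq// /p !deriv_prod_XsubC//.
have zsy : z \in rem y s by rewrite mem_rem_uniq// inE zy.
have ysz : y \in rem z s by rewrite mem_rem_uniq// inE eq_sym zy.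
rewrite (big_rem z zsy) (big_rem y ysz)/=.
have -> : rem y (rem z s) = rem z (rem y s).
  rewrite !rem_filter ?rem_uniq ?filter_uniq// -!filter_predI.
  by apply: eq_filter => w /=; rewrite andbC.
rewrite prodf_div !normrM distrC normfV -[in RHS]mulf_div divff ?mul1r//.
by rewrite normr_eq0 subr_eq0.
Qed.

(** * The recursion: splitting of [P], nested sets, derivative bounds *)

Lemma r_gt0 (R : realType) (gamma : nat -> R) (s : nat) :
  (forall k, (0 < k)%N -> 0 < gamma k) -> 0 < r gamma s.
Proof.
by move=> g0; elim: s => [|s IH] //=; rewrite mulr_gt0 ?g0// exprn_gt0.
Qed.

(* The shift by c carries the induction: [P_(s+1) - c] factors as
   [(P_s - u) (P_s - v)] with u and v again admissible shifts. *)
Lemma P_sub_split (R : realType) (gamma : nat -> R) (s : nat) (c : R) :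
  (forall k, (0 < k)%N -> 0 < gamma k < 1 / 4) ->
  - (r gamma s ^+ 2 / 4) < c <= 0 ->
  exists rs, [/\ uniq rs, size rs = (2 ^ s.+1)%N &
    P gamma s - c%:P = \prod_(z <- rs) ('X - z%:P)].
Proof.
move=> g; have r0 t : 0 < r gamma t by apply: r_gt0 => k /g /andP[].
elim: s c => [|s IH] c /(quadratic_roots (r0 _))[u [v [uv uDv uMv ub vb]]].
  (* Here [u] and [v] are the roots of $X^2 + X - c$, so their opposites are those of $X(X - 1) -
     c$. *)
  exists [:: - u; - v]; split => //=; first by rewrite inE eqr_opp uv.
  rewrite !big_cons big_nil mulr1 -[c]opprK -uMv !polyCN polyCM !opprK.
  have -> : u = - 1 - v by rewrite /= in uDv; lra.
  by rewrite polyCB polyCN; ring.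
(* As $\gamma_{s+1} < 1/4$, $r_{s+1} < r_s^2/4$, which makes [u] and [v] admissible shifts one level
   down. *)
have low w : - r gamma s.+1 <= w <= 0 -> - (r gamma s ^+ 2 / 4) < w <= 0.
  move=> /andP[wr ->]; rewrite andbT; apply: lt_le_trans wr.
  have /andP[_ gl] := g s.+1 isT.
  rewrite /= ltrN2 mulrC ltr_pM2l; first lra.
  by rewrite exprn_gt0.
have [su [usu ssu Pu]] := IH _ (low _ ub).
have [sv [usv ssv Pv]] := IH _ (low _ vb).
exists (su ++ sv); split.
- exact: uniq_cat_prod_XsubC uv usu usv Pu Pv.
- by rewrite size_cat ssu ssv addnn -mul2n -expnS.
- rewrite big_cat/= -Pu -Pv -[c]opprK -uMv -[gamma _ * _]/(r gamma s.+1).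
  have -> : r gamma s.+1 = - u - v by lra.
  by rewrite !polyCN polyCM polyCB polyCN; ring.
Qed.

(** A product $u(u + b)$ with $b > 0$ is nonpositive only for $u$ in $[-b, 0]$. This yields both the
    nesting of the sets [E] and the range needed for the derivative bounds. *)
Lemma P_leS (R : realType) (gamma : nat -> R) (s : nat) (x : R) :
  0 < r gamma s.+1 ->
  (P gamma s.+1).[x] <= 0 -> - r gamma s.+1 <= (P gamma s).[x] <= 0.
Proof.
move=> r0; rewrite [P _ _.+1]/= -[gamma _ * _]/(r gamma s.+1) hornerM hornerD hornerC.
move: (r gamma s.+1) r0 => b b0; set u := (P _ _).[x] => H.
have [u0|u0] := ltP 0 u.
  by move: H; rewrite pmulr_rle0//; lra.
rewrite andbT; case: (lerP (- b) u) => // ub.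
by move: H; rewrite leNgt nmulr_rgt0//; lra.
Qed.

Lemma E_anti (R : realType) (gamma : nat -> R) (s t : nat) :
  (forall k, (0 < k)%N -> 0 < gamma k) -> (s <= t)%N ->
  E gamma t `<=` E gamma s.
Proof.
move=> g /subnK <-; elim: (t - s)%N => // n IH x Ex; apply: IH.
by have /andP[] := P_leS (r_gt0 (n + s).+1 g) Ex.
Qed.

(** Lower levels follow from nesting, higher ones because [P gamma s] divides [P gamma t] for
    [s <= t]. *)
Lemma root_P_K (R : realType) (gamma : nat -> R) (s : nat) (x : R) :
  (forall k, (0 < k)%N -> 0 < gamma k) -> (P gamma s).[x] = 0 -> K gamma x.
Proof.
move=> g Px t _; have [st|ts] := leqP s t; last first.
  by apply: (E_anti g (ltnW ts)); rewrite /E/= Px.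
suff : (P gamma t).[x] = 0 by rewrite /E/= => ->.
by rewrite -(subnK st); elim: (t - s)%N => //= n IH; rewrite hornerM IH mul0r.
Qed.

Lemma E_sub01 (R : realType) (gamma : nat -> R) (s : nat) :
  (forall k, (0 < k)%N -> 0 < gamma k) -> E gamma s `<=` `[0, 1].
Proof.
move=> g x /(E_anti g (leq0n s)); rewrite /E/= !hornerE in_itv/= => x0.
by apply/andP; split; nra.
Qed.

(* Here [2 P_s + r_(s+1)] is the new factor of [P_(s+1)'], and its square is
   [r_(s+1)^2 + 4 P_(s+1)]. *)
Lemma deriv_P_bounds (R : realType) (gamma : nat -> R) (s : nat) (x : R) :
  (forall k, (0 < k)%N -> 0 < gamma k <= 1 / 4) ->
  - r gamma s.+1 <= (P gamma s).[x] <= 0 ->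
  (\prod_(1 <= k < s.+1) r gamma k) * \prod_(1 <= k < s.+2) (1 - 4 * gamma k)
    <= `|(P gamma s)^`().[x]| <= \prod_(1 <= k < s.+1) r gamma k.
Proof.
move=> g; have r0 t : 0 < r gamma t by apply: r_gt0 => k /g /andP[].
(* The lower bound comes from $a^2 \ge b^2(1 - 4e) \ge b^2(1 - 4e)^2$, where $0 \le 1 - 4e \le
   1$. *)
have sqr_bounds (a b d e : R) : 0 < b -> 0 < e <= 1 / 4 ->
    a ^+ 2 = b ^+ 2 + 4 * d -> - (e * b ^+ 2) <= d <= 0 ->
    b * (1 - 4 * e) <= `|a| <= b.
  move=> b0 /andP[e0 e4] ad /andP[d1 d2].
  have b2 : 0 < b ^+ 2 by rewrite exprn_gt0.
  have be0 : 0 <= b * (1 - 4 * e) by rewrite mulr_ge0 ?(ltW b0)//; lra.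
  have a2 : `|a| ^+ 2 = b ^+ 2 + 4 * d by rewrite real_normK ?num_real.
  have ee : (1 - 4 * e) ^+ 2 <= 1 - 4 * e by rewrite expr2 ler_piMr; lra.
  apply/andP; split.
    rewrite -ler_sqr ?nnegrE// a2 exprMn.
    by apply: le_trans (ler_wpM2l (ltW b2) ee) _; lra.
  by rewrite -ler_sqr ?nnegrE ?(ltW b0)// a2; lra.
elim: s => [|s IH] Ps.
  (* Base case: $(2x - 1)^2 = 1 + 4x(x - 1)$, with $b = r_0 = 1$ and $e = \gamma_1 = r_1$. *)
  rewrite big_geq// big_nat1; apply: (sqr_bounds _ _ (P gamma 0).[x]) => //.
  - exact: g.
  - by rewrite /= derivM -polyC1 derivXsubC derivX !hornerE/=; ring.
have /IH /andP[IH1 IH2] : - r gamma s.+1 <= (P gamma s).[x] <= 0.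
  by apply: P_leS => //; case/andP: Ps.
have dP : (P gamma s.+1)^`().[x] =
    (P gamma s)^`().[x] * (2 * (P gamma s).[x] + r gamma s.+1).
  rewrite [P _ _.+1]/= -[gamma _ * _]/(r gamma s.+1) derivM derivD derivC.
  by rewrite !hornerE; ring.
have /andP[B1 B2] : r gamma s.+1 * (1 - 4 * gamma s.+2) <=
    `|2 * (P gamma s).[x] + r gamma s.+1| <= r gamma s.+1.
  (* Taking $e = \gamma_{s+2}$ fits because $r_{s+2} = \gamma_{s+2} r_{s+1}^2$. *)
  apply: (sqr_bounds _ _ (P gamma s.+1).[x]) => //; first exact: g.
  rewrite [P _ _.+1]/= -[gamma _ * _]/(r gamma s.+1) !hornerE/=.
  ring.
rewrite dP normrM (big_nat_recr s.+1)// (big_nat_recr s.+2)// mulrACA.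
have D0 : 0 <= \prod_(1 <= k < s.+1) r gamma k.
  by rewrite prodr_ge0// => k _; exact: ltW.
have M0 : 0 <= \prod_(1 <= k < s.+2) (1 - 4 * gamma k).
  rewrite big_seq prodr_ge0// => k; rewrite mem_index_iota => /andP[/g k0 _].
  lra.
have M1 : 0 <= 1 - 4 * gamma s.+2 by have := g s.+2 isT; lra.
apply/andP; split; apply: ler_pM => //; apply: mulr_ge0 => //.
exact: ltW (r0 s.+1).
Qed.

(** * From derivative bounds to the Lebesgue constant *)

Lemma expR_le_prod (R : realType) (gamma : nat -> R) (n : nat) :
  (forall k, (0 < k)%N -> 0 <= gamma k <= 1 / 8) ->
  expR (- (16 * \sum_(1 <= k < n) gamma k)) <=
    \prod_(1 <= k < n) (1 - 4 * gamma k).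
Proof.
move=> g; rewrite mulr_sumr -sumrN expR_sum big_seq [leRHS]big_seq.
apply: ler_prod => k; rewrite mem_index_iota => /andP[/g /andP[g0 g8] _].
(* Factor by factor, $e^{-16t} \le 1/(1 + 16t) \le 1 - 4t$; the last inequality holds since $(1 -
   4t)(1 + 16t) = 1 + t(12 - 64t)$. *)
rewrite expR_ge0 expRN /=; apply: (@le_trans _ _ (1 + 16 * gamma k)^-1).
  by rewrite lef_pV2 ?posrE ?expR_gt0 ?expR_ge1Dx//; lra.
have : 0 <= gamma k * (12 - 64 * gamma k) by rewrite mulr_ge0//; lra.
by rewrite -div1r ler_pdivrMr; lra.
Qed.

(** The sum at the removed node [y] has [(size s).-1] terms $|p'(y)|/|p'(z)|$, each at least [c]. *)
Lemma lebesgue_constant_ge (R : realType) (s : seq R) (A : set R) (y c : R) :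
  uniq s -> y \in s -> A y ->
  let p := \prod_(w <- s) ('X - w%:P) in
  (forall z, z \in s -> c * `|p^`().[z]| <= `|p^`().[y]|) ->
  ((c * (size s).-1%:R)%:E <= lebesgue_constant ([set` s] `\ y) A)%E.
Proof.
move=> us ys Ay p Hc; apply: le_ereal_sup_tmp.
exists (\sum_(z \in [set` s] `\ y) `|Defs.lagrange ([set` s] `\ y) z y|)%:E.
  by exists y.
rewrite lee_fin.
have sE : [set` s] `\ y = [set` rem y s].
  apply/seteqP; split=> w /=; rewrite mem_rem_uniq// inE.
    by move=> [-> /eqP ->].
  by move=> /andP[/eqP ? ->].
rewrite [X in _ <= \big[_/_]_(_ \in X) _]sE -fsbig_seq ?rem_uniq//.
have -> : c * (size s).-1%:R = \sum_(z <- rem y s) c.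
  by rewrite big_const_seq count_predT iter_addr_0 size_rem// mulr_natr.
rewrite big_seq [leRHS]big_seq; apply: ler_sum => z.
rewrite mem_rem_uniq// inE => /andP[zy zs].
rewrite norm_lagrange_node// ler_pdivlMr ?Hc// normr_gt0.
exact: deriv_prod_XsubC_neq0.
Qed.

Theorem theorem6p4 (R : realType) (gamma : nat -> R)
  (gamma_gt0 : forall k : nat, (0 < k)%N -> 0 < gamma k)
  (gamma_le : forall k : nat, (0 < k)%N -> gamma k <= 1 / 32)
  (gamma_summable : cvgn (fun n : nat => \sum_(1 <= k < n) gamma k))
  (C0 : R)
  (C0E : C0 = expR (16 * limn (fun n : nat => \sum_(1 <= k < n) gamma k)))
  (s N : nat) (s_gt0 : (0 < s)%N) (NE : N = (2 ^ s - 1)%N)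
  (X : set R) (y : R) (Yy : Y gamma s.-1 y) (XE : X = Y gamma s.-1 `\ y) :
  ((C0^-1 * (N%:R - 2))%:E < lebesgue_constant X (K gamma))%E.
Proof.
(* From here [s] is one less than in the statement, so [P gamma s] has degree $2^{s+1} = N + 1$. *)
case: s s_gt0 NE Yy XE => // s _ NE Yy XE; rewrite [s.+1.-1]/= in Yy XE.
have g4 k : (0 < k)%N -> 0 < gamma k < 1 / 4.
  by move=> k0; have := gamma_gt0 k k0; have := gamma_le k k0; lra.
have r0 t : 0 < r gamma t by exact: r_gt0.
have [|rs [urs srs]] := @P_sub_split R gamma s 0 g4.
  by rewrite lexx andbT oppr_lt0 divr_gt0// exprn_gt0.
rewrite subr0 => Prs.
have rootE z : (P gamma s).[z] = 0 <-> z \in rs.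
  by rewrite -root_prod_XsubC -Prs; split=> /rootP.
have simple t : (P gamma s).[t] = 0 -> (P gamma s)^`().[t] != 0.
  by move/rootE; rewrite Prs; exact: deriv_prod_XsubC_neq0.
have YE : Y gamma s = [set` rs].
  apply/seteqP; split=> z /=; rewrite -rootE;
    by have [] := endpoints_horner_le0 z (E_sub01 gamma_gt0) simple.
rewrite XE YE; rewrite YE /= in Yy.
have Ky : K gamma y by apply: (@root_P_K _ _ s) => //; exact/rootE.
have sum_le n :
    \sum_(1 <= k < n) gamma k <= limn (fun n => \sum_(1 <= k < n) gamma k).
  apply: (nondecreasing_cvgn_le _ gamma_summable n).
  apply/nondecreasing_seqP => -[|m]; first by rewrite !big_geq.
  by rewrite [leRHS]big_nat_recr//= lerDl ltW// gamma_gt0.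
have C0i0 : 0 < C0^-1 by rewrite invr_gt0 C0E expR_gt0.
have C0_le : C0^-1 <= \prod_(1 <= k < s.+2) (1 - 4 * gamma k).
  rewrite C0E -expRN; apply: le_trans (expR_le_prod _ _) => [|k k0].
    by rewrite ler_expR lerN2 ler_pM2l.
  by have := gamma_gt0 k k0; have := gamma_le k k0; lra.
have bnd z : z \in rs -> (\prod_(1 <= k < s.+1) r gamma k) *
    \prod_(1 <= k < s.+2) (1 - 4 * gamma k) <= `|(P gamma s)^`().[z]|
    <= \prod_(1 <= k < s.+1) r gamma k.
  move=> /rootE Pz; apply: deriv_P_bounds => [k /g4 /andP[-> /ltW]//|].
  by rewrite Pz lexx andbT oppr_le0 ltW.
(* Strictness comes from counting: there are [N] nodes, and $N > N - 2$. *)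
apply: (@lt_le_trans _ _ (C0^-1 * (size rs).-1%:R)%:E).
  by rewrite lte_fin ltr_pM2l// srs NE subn1; lra.
apply: lebesgue_constant_ge => // z zrs; rewrite -Prs.
have /andP[yl _] := bnd y Yy; have /andP[_ zu] := bnd z zrs.
apply: le_trans yl; rewrite [leRHS]mulrC.
by apply: ler_pM => //; exact: ltW.
Qed.
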